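(* Let $G_1$ and $G_2$ be groups whose orders are even powers of $2$, and suppose $G_2$ is generated by $\{x_1, x_2, \ldots, x_n\}$. Let $D_1$ and $D_2$ be symplectic difference sets in $G_1$ and $G_2$, respectively, and let $\phi : G_2 \to \mathrm{Aut}(G_1)$ be a homomorphism, writing $\phi_g = \phi(g)$. If $\phi_{x_i}(D_1) = D_1$ for all $i = 1, \ldots, n$, then \[D = \big(D_1 \times (G_2 - D_2)\big) \cup \big((G_1 - D_1) \times D_2\big)\] is a symplectic difference set in $G_1 \rtimes_\phi G_2$.
   Context: A $(v,k,\lambda)$ difference set in a group $G$ of order $v$ is a subset $D$ of size $k$ such that the multiset $\{d_1 d_2^{-1} : d_1,d_2 \in D\}$ contains every non-identity element of $G$ exactly $\lambda$ times. Its development is the symmetric design with points the elements of $G$, blocks the left translates $gD$ ($g\in G$), incidence by membership. Two symmetric designs with incidence matrices $A_1, A_2$ are isomorphic iff $A_1 = P A_2 Q$ for some permutation matrices $P, Q$. The symplectic design on $2^{2m}$ points is the design with incidence matrix $A = -\tfrac12\big((J_4 - 2I_4)^{\otimes m} - J\big)$, where $\otimes$ is the Kronecker product, $I_4$, $J_4$ are the $4\times 4$ identity and all-ones matrices and $J$ is the $4^m \times 4^m$ all-ones matrix. A symplectic difference set is a difference set (in a group of order $2^{2m}$) whose development is isomorphic to the symplectic design on $2^{2m}$ points. For a homomorphism $\phi: H \to \mathrm{Aut}(N)$, the semi-direct product $N \rtimes_\phi H$ has underlying set $N \times H$ and multiplication $(n_1,h_1)(n_2,h_2) = (n_1 \phi(h_1)(n_2),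 h_1 h_2)$; the set $D$ is regarded as a subset of this underlying set $G_1 \times G_2$. *)

(* Defs.v *)
From HB Require Import structures.
From mathcomp Require Import all_boot all_order all_algebra all_fingroup.
From mathcomp Require Import mxtens.

Set Implicit Arguments.
Unset Strict Implicit.
Unset Printing Implicit Defensive.

Import GRing.Theory.
Local Open Scope ring_scope.

Definition difference_set (v k lam : nat) (G : finGroupType) (D : {set G}) :
    Prop :=
  [/\ #|G| = v, #|D| = k &
      forall g : G, g != 1%g ->
        #|[set d in setX D D | (d.1 * d.2^-1)%g == g]| = lam].

(* Rows are indexed by the points x and columns by the blocks g D, both in the
   order of enum G. *)
Definition development_mx (G : finGroupType) (D : {set G}) : 'M[rat]_#|G| :=
  \matrix_(i, j) (enum_val i \in (enum_val j *: D)%g)%:R.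

(* The sizes v1 and v2 may be propositionally but not definitionally equal,
   hence the cast. *)
Definition isomorphic_designs (v1 v2 : nat)
    (A1 : 'M[rat]_v1) (A2 : 'M[rat]_v2) : Prop :=
  exists e : v2 = v1, exists P Q : 'M[rat]_v1,
    [/\ is_perm_mx P, is_perm_mx Q & A1 = P *m castmx (e, e) A2 *m Q].

(* A ^t m is the m-th Kronecker power, equal to the 1 x 1 identity for m = 0. *)
Definition symplectic_mx (m : nat) : 'M[rat]_(4 ^ m) :=
  - (1 / 2) *: ((const_mx 1 - 2 *: 1%:M : 'M[rat]_4) ^t m - const_mx 1).

Definition symplectic_difference_set (G : finGroupType) (D : {set G}) : Prop :=
  exists m k lam : nat,
    difference_set (2 ^ (2 * m)) k lam D /\
    isomorphic_designs (development_mx D) (symplectic_mx m).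

(* Homomorphisms H -> Aut(N) for the composition convention
   phi (h1 h2) = phi h1 \o phi h2. The product of {perm N} composes in the
   opposite order, so these are not the group morphisms from H to Aut [set: N]
   of the library. *)
Record autHom (N H : finGroupType) := AutHom {
  autfun :> H -> {perm N};
  autfun_Aut : forall h, autfun h \in Aut [set: N];
  autfunM : forall h1 h2 n, autfun (h1 * h2)%g n = autfun h1 (autfun h2 n)
}.

(* An alias of N * H, so as not to inherit the direct product structure. *)
Definition semidirect (N H : finGroupType) (phi : autHom N H) : Type :=
  (N * H)%type.

Section SemidirectGroup.
Local Open Scope group_scope.
Variables (N H : finGroupType) (phi : autHom N H).
Implicit Types u v w : semidirect phi.

HB.instance Definition _ := Finite.copy (semidirect phi) (N * H)%type.

Definition semidirect_mul u v : semidirect phi :=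
  (u.1 * phi u.2 v.1, u.2 * v.2).
Definition semidirect_one : semidirect phi := (1, 1).
Definition semidirect_inv u : semidirect phi :=
  (phi u.2^-1 u.1^-1, u.2^-1).

Lemma autfun_mul h (a b : N) : phi h (a * b) = phi h a * phi h b.
Proof.
have /setIdP[_ /morphicP fM] := autfun_Aut phi h.
by rewrite fM ?inE.
Qed.

Lemma autfun1 (a : N) : phi 1 a = a.
Proof. by apply: (@perm_inj _ (phi 1)); rewrite -autfunM mulg1. Qed.

Lemma semidirect_mulA : associative semidirect_mul.
Proof.
move=> u v w; rewrite /semidirect_mul /=.
by rewrite autfun_mul autfunM !mulgA.
Qed.

Lemma semidirect_mul1 : left_id semidirect_one semidirect_mul.
Proof. by case=> a h; rewrite /semidirect_mul /= autfun1 !mul1g. Qed.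

Lemma semidirect_mulV :
  left_inverse semidirect_one semidirect_inv semidirect_mul.
Proof.
case=> a h; rewrite /semidirect_mul /semidirect_inv /=.
rewrite -autfun_mul !mulVg; congr (_, _).
by apply: (mulgI (phi h^-1 1)); rewrite -autfun_mul !mulg1.
Qed.

HB.instance Definition _ := Finite_isGroup.Build (semidirect phi)
  semidirect_mulA semidirect_mul1 semidirect_mulV.

End SemidirectGroup.

(* Main.v *)
(* Replace a difference set D by its sign function f_D = 1 - 2 1_D.  A design is
   symplectic iff the matrix f_D(g^-1 x) agrees, up to independent permutations
   of rows and columns, with (J - 2 I)^t m.  The sign function of the set in the
   theorem is f_D1(a) f_D2(b); since D1 is stable under phi, its matrix is the
   Kronecker product of those of D1 and D2, and Kronecker powers are additive in
   the exponent. *)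
Require Import Defs.
From mathcomp Require Import all_boot all_order all_algebra all_fingroup.
From mathcomp Require Import ring lra mxtens.

Set Implicit Arguments.
Unset Strict Implicit.
Unset Printing Implicit Defensive.

Import GRing.Theory Num.Theory.
Local Open Scope ring_scope.

Section TensorPower.
Variable R : comPzRingType.

Lemma tens_scalar_scalar_mx m n (c d : R) :
  (c%:M : 'M_m) *t (d%:M : 'M_n) = (c * d)%:M.
Proof.
apply/matrixP => i j.
case: (mxtens_indexP i) => i1 i2; case: (mxtens_indexP j) => j1 j2.
rewrite tensmxE !mxE (can_eq (@mxtens_indexK _ _)) xpair_eqE.
by case: (i1 == j1); case: (i2 == j2); rewrite ?mulr0 ?mul0r.
Qed.

Lemma ntensmx_gram n (A : 'M[R]_n) (c : R) m :
  A^T *m A = c%:M -> (A ^t m)^T *m A ^t m = (c ^+ m)%:M.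
Proof.
move=> AA; case: m => [|m]; first by rewrite ntensmx0 trmx1 mulmx1.
elim: m => [|m IHm]; first by rewrite ntensmx1 expr1.
by rewrite ntensmxSS trmx_tens tensmx_mul AA IHm tens_scalar_scalar_mx -exprS.
Qed.

(** [A ^t 1] is [A] itself, not a product with a 1 x 1 factor, so [ntensmxSS] starts at exponent 2
    and exponent 1 is handled by [fst]. *)
Lemma ntensmxS_index n (A : 'M[R]_n) m :
  exists2 f : 'I_n * 'I_(n ^ m) -> 'I_(n ^ m.+1), bijective f &
    forall i j k l, (A ^t m.+1) (f (i, j)) (f (k, l)) = A i k * (A ^t m) j l.
Proof.
case: m => [|m].
  exists fst; first by exists (fun i => (i, 0)) => // -[i j]; rewrite [j]ord1.
  by move=> i j k l; rewrite [j]ord1 [l]ord1 ntensmx0 mxE mulr1.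
exists (@mxtens_index n (n ^ m.+1)); last by move=> i j k l; rewrite ntensmxSS tensmxE.
exact: Bijective (@mxtens_indexK _ _) (@mxtens_unindexK _ _).
Qed.

(** Stating additivity through a bijection [f] of indices, common to rows and columns, avoids casts
    between [n ^ m1 * n ^ m2] and [n ^ (m1 + m2)]. *)
Lemma ntensmxD_index n (A : 'M[R]_n) m1 m2 :
  exists2 f : 'I_(n ^ m1) * 'I_(n ^ m2) -> 'I_(n ^ (m1 + m2)), bijective f &
    forall i j k l,
      (A ^t (m1 + m2)) (f (i, j)) (f (k, l)) = (A ^t m1) i k * (A ^t m2) j l.
Proof.
elim: m1 => [|m1 [f [f' fK f'K] fE]].
  exists snd; first by exists (fun j => (0, j)) => // -[i j]; rewrite [i]ord1.
  by move=> i j k l; rewrite [i]ord1 [k]ord1 ntensmx0 mxE mul1r.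
have [g [g' gK g'K] gE] := ntensmxS_index A m1.
have [h [h' hK h'K] hE] := ntensmxS_index A (m1 + m2).
(* [g'] splits the first index into head and tail, [f] merges the tail with the second index, and
   [h] puts the head back. *)
exists (fun u => h ((g' u.1).1, f ((g' u.1).2, u.2))).
  exists (fun i => (g ((h' i).1, (f' (h' i).2).1), (f' (h' i).2).2)) => [[i j]|i].
    by rewrite hK /= fK /= -surjective_pairing g'K.
  by rewrite /= gK /= -surjective_pairing f'K -surjective_pairing h'K.
move=> i j k l; rewrite -[in RHS](g'K i) -[in RHS](g'K k) /= hE fE mulrA.
by case: (g' i) (g' k) => i1 i2 [k1 k2]; rewrite gE.
Qed.

End TensorPower.

Definition sign_mx (m : nat) : 'M[rat]_(4 ^ m) :=
  (const_mx 1 - 2 *: 1%:M : 'M[rat]_4) ^t m.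

(** [J - 2 I] of order 4 is a Hadamard matrix: in the product of columns [i != j], rows [i] and [j]
    give -1 and the other two rows give 1. *)
Lemma sign_mx_gram m : (sign_mx m)^T *m sign_mx m = (4 ^+ m)%:M.
Proof.
apply: ntensmx_gram; apply/matrixP => i j.
rewrite !mxE (bigD1 i) //= !mxE eqxx.
case: (eqVneq i j) => [<-|nij].
  rewrite (eq_bigr (fun=> 1)) => [|k ki]; last first.
    by rewrite !mxE (negPf ki) mulr0 subr0 mulr1.
  by rewrite sumr_const cardC1 card_ord.
rewrite (bigD1 j) 1?eq_sym //= !mxE eqxx eq_sym (negPf nij).
rewrite (eq_bigr (fun=> 1)) => [|k /andP[ki kj]]; last first.
  by rewrite !mxE (negPf ki) (negPf kj) mulr0 subr0 mulr1.
rewrite sumr_const.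
suff -> : #|[pred k | (k != i) && (k != j)]| = 2 by [].
have := cardC (pred2 i j); rewrite card2 nij card_ord => /(@addnI 2 _ 2) <-.
by apply: eq_card => k; rewrite !inE negb_or.
Qed.

Lemma symplectic_mxE m i j (b : bool) :
  (symplectic_mx m i j == b%:R) = ((-1) ^+ b == sign_mx m i j).
Proof.
rewrite !mxE -/(sign_mx m).
by apply/eqP/eqP; case: b; rewrite /= => H; lra.
Qed.

(* The columns of [sign_mx m] are orthogonal, so for [g != 1] the sign vectors of
   [D] and [g D] are: [#|G| - 4 #|D| + 4 #|D :&: g D| = 0]. *)
Lemma symplecticP (G : finGroupType) (D : {set G}) :
  symplectic_difference_set D <->
  exists m (p q : G -> 'I_(4 ^ m)), [/\ bijective p, bijective q &
    forall x g, (-1) ^+ (g^-1 * x \in D)%g = sign_mx m (p x) (q g)].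
Proof.
split.
  case=> m [k] [lam] [_] [e] [_] [_] [/is_perm_mxP[s ->] /is_perm_mxP[t ->]].
  (* [col_permE] produces [perm_mx] of an inverse, hence the double inverse; blocks are then indexed
     through [t^-1]. *)
  rewrite -(invgK t) -row_permE -col_permE => /matrixP E.
  exists m, (cast_ord (esym e) \o s \o enum_rank).
  exists (cast_ord (esym e) \o (t^-1)%g \o enum_rank).
  have bij_e : bijective (cast_ord (esym e)).
    exact: Bijective (cast_ordKV _) (cast_ordK _).
  have bij_index (s' : {perm 'I_#|G|}) :
      bijective (cast_ord (esym e) \o s' \o enum_rank).
    exact: bij_comp (bij_comp bij_e (injF_bij (@perm_inj _ s'))) (@enum_rank_bij G).
  split=> [||x g]; [exact: bij_index | exact: bij_index |].
  apply/eqP; rewrite -symplectic_mxE -mem_lcoset /=; apply/eqP.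
  have := E (enum_rank x) (enum_rank g).
  by rewrite mxE !enum_rankK [RHS]mxE [RHS]mxE castmxE => <-.
case=> m [p] [q] [bp bq E].
have [pI qI] : injective p /\ injective q by split; exact: bij_inj.
have oG : (4 ^ m)%N = #|G| by rewrite (bij_eq_card bp) card_ord.
(* For nontrivial [G], [lam] is forced by [v - 4 k + 4 lam = 0]; for trivial [G] its value is
   irrelevant. *)
exists m, #|D|, ((4 * #|D| - #|G|) %/ 4)%N; split; last first.
  have sI : injective (fun i : 'I_#|G| => cast_ord oG (p (enum_val i))).
    by move=> i j /cast_ord_inj /pI /enum_val_inj.
  have tI : injective (fun i : 'I_#|G| => cast_ord oG (q (enum_val i))).
    by move=> i j /cast_ord_inj /qI /enum_val_inj.
  exists oG, (perm_mx (perm sI)), (perm_mx (perm tI)^-1)%g.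
  rewrite !perm_mx_is_perm -row_permE -col_permE; split=> //.
  apply/matrixP => i j; rewrite mxE [RHS]mxE [RHS]mxE castmxE !permE.
  by rewrite !cast_ordK mem_lcoset; apply/esym/eqP; rewrite symplectic_mxE E.
split=> // [|g g1]; first by rewrite -oG expnM.
(* A pair with quotient [g] is determined by its first entry [d], the second being [g^-1 * d]. *)
have cD : #|[set d in setX D D | d.1 * d.2^-1 == g]%g| = #|D :&: g *: D|%g.
  rewrite -(card_imset (D :&: g *: D)%g (f := fun d => (d, g^-1 * d)%g)); last first.
    by move=> d d' [].
  apply: eq_card => -[d d']; apply/idP/imsetP; rewrite !inE /=.
    case/andP=> /andP[dD d'D] /eqP <-; exists d; last first.
      by rewrite invMg invgK mulgKV.
    by rewrite inE dD mem_lcoset invMg invgK mulgKV.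
  case=> c; rewrite inE mem_lcoset => /andP[cD gcD] [-> ->].
  by rewrite cD gcD invMg invgK mulKVg eqxx.
rewrite cD; have : \sum_x (-1) ^+ (x \in D) * (-1) ^+ (x \in g *: D)%g = 0 :> rat.
  (* Columns [q 1] and [q g] carry the sign functions of [D] and [g *: D]; their Gram entry lies off
     the diagonal. *)
  have /matrixP/(_ (q 1%g) (q g)) := sign_mx_gram m.
  rewrite !mxE (inj_eq qI) eq_sym (negPf g1) mulr0n.
  rewrite (reindex p) /=; last exact: onW_bij.
  move=> sum0; rewrite -[RHS]sum0.
  by apply: eq_bigr => x _; rewrite mxE -!E invg1 mul1g mem_lcoset.
have -> : \sum_x (-1) ^+ (x \in D) * (-1) ^+ (x \in g *: D)%g =
          \sum_x (1 - 2 * (x \in D)%:R - 2 * (x \in g *: D)%g%:R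
             + 4 * (x \in D :&: g *: D)%g%:R) :> rat.
  by apply: eq_bigr => x _; rewrite inE; do 2!case: (x \in _) => /=; ring.
have card_rat (B : {set G}) : \sum_x (x \in B)%:R = #|B|%:R :> rat.
  by rewrite -sumr_const [RHS]big_mkcond; apply: eq_bigr => x _; case: (x \in B).
rewrite big_split /= !sumrB sumr_const -!mulr_sumr !card_rat card_lcoset.
rewrite -[#|_|]/(#|G|) => H.
have {}H : (4 * #|D :&: g *: D|%g + #|G| = 4 * #|D|)%N.
  apply/eqP; rewrite -(eqr_nat rat) natrD !natrM; apply/eqP; lra.
by rewrite -H addnK mulKn.
Qed.

(** The elements [h] with [phi h] preserving membership in [D] form a subgroup, which contains [A]
    and hence [<<A>>]. *)
Lemma autHom_stable (N H : finGroupType) (phi : autHom N H) (A : {set H})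
    (D : {set N}) :
  (forall h, h \in A -> [set phi h d | d in D] = D) ->
  forall h, h \in <<A>>%g -> forall a, (phi h a \in D) = (a \in D).
Proof.
move=> sA h; pose S := [set h | [forall a, (phi h a \in D) == (a \in D)]].
have gS : group_set S.
  apply/group_setP; split=> [|h1 h2].
    by rewrite inE; apply/forallP => a; rewrite autfun1.
  rewrite !inE => /forallP S1 /forallP S2; apply/forallP => a.
  by rewrite autfunM (eqP (S1 _)) (eqP (S2 _)).
have /subsetP sAS : <<A>>%g \subset Group gS.
  rewrite gen_subG; apply/subsetP => h' /sA h'D.
  rewrite inE; apply/forallP => a.
  by rewrite -{1}h'D mem_imset //; exact: perm_inj.
by move/sAS; rewrite inE => /forallP S_h a; apply/eqP.
Qed.

Theorem theorem4p2 (G1 G2 : finGroupType) (m1 m2 : nat)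
    (oG1 : #|G1| = (2 ^ (2 * m1))%N) (oG2 : #|G2| = (2 ^ (2 * m2))%N)
    (n : nat) (x : 'I_n -> G2)
    (genG2 : <<[set x i | i : 'I_n]>>%g = [set: G2])
    (D1 : {set G1}) (D2 : {set G2})
    (hD1 : symplectic_difference_set D1) (hD2 : symplectic_difference_set D2)
    (phi : autHom G1 G2)
    (hphi : forall i : 'I_n, [set phi (x i) d | d in D1] = D1) :
  symplectic_difference_set
    (setX D1 (~: D2) :|: setX (~: D1) D2 : {set semidirect phi}).
Proof.
have D1phi h a : (phi h a \in D1) = (a \in D1).
  apply: (@autHom_stable _ _ phi [set x i | i : 'I_n]); last by rewrite genG2.
  by move=> _ /imsetP[i _ ->].
have [k1 [p1 [q1 [bp1 bq1 E1]]]] := (symplecticP D1).1 hD1.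
have [k2 [p2 [q2 [bp2 bq2 E2]]]] := (symplecticP D2).1 hD2.
have [f bf fE] :=
  ntensmxD_index (const_mx 1 - 2 *: 1%:M : 'M[rat]_4) k1 k2.
have pair_bij (r1 : G1 -> 'I_(4 ^ k1)) (r2 : G2 -> 'I_(4 ^ k2)) :
    bijective r1 -> bijective r2 ->
    bijective (fun u : semidirect phi => f (r1 u.1, r2 u.2)).
  case=> s1 r1K s1K [s2 r2K s2K]; apply: (bij_comp bf).
  exists (fun v => (s1 v.1, s2 v.2)) => -[a b] /=.
    by rewrite r1K r2K.
  by rewrite s1K s2K.
apply/symplecticP; exists (k1 + k2)%N.
exists (fun u => f (p1 u.1, p2 u.2)), (fun u => f (q1 u.1, q2 u.2)).
split; [exact: pair_bij | exact: pair_bij |] => -[a b] [c d].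
(* The product of two signs is the sign of the exclusive or, and the set is the symmetric difference
   of [D1 x G2] and [G1 x D2]. *)
rewrite [RHS]fE -/(sign_mx k1) -/(sign_mx k2) -E1 -E2 -signr_addb.
congr (_ ^+ nat_of_bool _).
(* The first component of [(c, d)^-1 * (a, b)] is [phi d^-1 (c^-1 * a)]; stability of [D1] removes
   the twist. *)
rewrite !inE /= -autfun_mul D1phi.
by do 2!case: (_ \in _).
Qed.
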